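(* Let $J_4$ be the $3$-graph on vertex set $\{1,2,3,4,5\}$ with $3$-edges $123,124,125,134,135,145$. For every positive integer $n$, $$\mathrm{co^+ex}(n,J_4)\ge 4\left\lfloor\frac n7\right\rfloor,$$ and therefore $\gamma^+(J_4)\ge 4/7$.
   Context: A $3$-graph is a finite $3$-uniform hypergraph; an edge is written as the concatenation of its vertices. The minimum positive co-degree $\delta_2^+(H)$ of a non-empty $3$-graph $H$ is the maximum $k$ such that every pair of vertices contained in some edge of $H$ is contained in at least $k$ distinct edges of $H$; by convention it is $0$ if $H$ has no edges. A hypergraph is $F$-free if it has no (not necessarily induced) subhypergraph isomorphic to $F$. $\mathrm{co^+ex}(n,F)$ is the maximum of $\delta_2^+(H)$ over all $n$-vertex $F$-free $3$-graphs $H$, and $\gamma^+(F)=\lim_{n\to\infty}\mathrm{co^+ex}(n,F)/n$ (this limit exists). *)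

(* Defs.v *)
From HB Require Import structures.
From mathcomp Require Import all_boot all_order all_algebra.
From mathcomp Require Import all_classical all_reals all_analysis.

Set Implicit Arguments.
Unset Strict Implicit.
Unset Printing Implicit Defensive.

Import Order.TTheory GRing.Theory Num.Theory.
Import numFieldNormedType.Exports.

Record threegraph (V : finType) := ThreeGraph {
  edges : {set {set V}};
  edges_card : [forall e in edges, #|e| == 3] }.

HB.instance Definition _ (V : finType) := [isSub for @edges V].
HB.instance Definition _ (V : finType) := [Finite of threegraph V by <:].

Definition codegree (V : finType) (H : threegraph V) (p : {set V}) : nat :=
  #|[set e in edges H | p \subset e]|.

Definition covered_pair (V : finType) (H : threegraph V) (p : {set V}) : bool :=
  (#|p| == 2) && [exists e in edges H, p \subset e].

(* The range of k is finite so that the maximum is a bigop; no admissible k is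
   lost, because a non-empty H has a covered pair, of codegree at most
   #|edges H|. *)
Definition min_pos_codegree (V : finType) (H : threegraph V) : nat :=
  if edges H == finset.set0 then 0
  else \max_(k < #|edges H|.+1 |
               [forall p, covered_pair H p ==> (k <= codegree H p)]) k.

(* An injection mapping edges to edges exhibits a copy of F in H; its image
   need not be an induced subhypergraph. *)
Definition embedding (W V : finType) (F : threegraph W) (H : threegraph V)
    (f : {ffun W -> V}) : bool :=
  injectiveb f && [forall e in edges F, (f @: e)%SET \in edges H].

Definition hfree (W V : finType) (F : threegraph W) (H : threegraph V) : bool :=
  ~~ [exists f : {ffun W -> V}, embedding F H f].

(* As all notions are invariant under isomorphism, 'I_n serves as the vertex
   set of every n-vertex 3-graph. *)
Definition coex (W : finType) (n : nat) (F : threegraph W) : nat :=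
  \max_(H : threegraph 'I_n | hfree F H) min_pos_codegree H.

Definition gamma_plus (R : realType) (W : finType) (F : threegraph W) : R :=
  limn (fun n : nat => ((coex n F)%:R / n%:R : R)%R).

(* The element v of 'I_5 stands for the vertex labelled v + 1. *)
Definition triple (a b c : nat) : {set 'I_5} :=
  [set v : 'I_5 | v.+1 \in [:: a; b; c]]%SET.

Definition J4_edges : {set {set 'I_5}} :=
  [set triple 1 2 3; triple 1 2 4; triple 1 2 5;
       triple 1 3 4; triple 1 3 5; triple 1 4 5]%SET.

Fact J4_edges_card : [forall e in J4_edges, #|e| == 3].
Proof.
apply/'forall_implyP => e; rewrite !finset.inE -!orbA.
by move=> /or4P[|||/or3P[]] /eqP->;
  rewrite -sum1_card big_mkcond !big_ord_recl big_ord0 !finset.inE.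
Qed.

Definition J4 : threegraph 'I_5 := ThreeGraph J4_edges_card.

(* Main.v *)
(* The complement of the Fano plane has positive co-degree 4, and it is
    J4-free because the link of each vertex is the octahedron K_{2,2,2}, which
    contains no K_4. As every pair of vertices of J4 lies in an edge, blow-ups
    of J4-free 3-graphs are J4-free, so that
    (n %/ m) * coex m J4 <= coex n J4; the case m = 7 is the bound on coex, and
    in general this forces coex n J4 / n to converge to its supremum. *)

Require Import Defs.
From mathcomp Require Import all_boot all_order all_algebra.
From mathcomp Require Import all_classical all_reals all_analysis.
From mathcomp Require Import lra.

Set Implicit Arguments.
Unset Strict Implicit.
Unset Printing Implicit Defensive.

Import Order.TTheory GRing.Theory Num.Theory.
Import numFieldNormedType.Exports.

Section ThreeGraphs.
Import boot.fintype boot.bigop boot.finset.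

(** * Co-degrees and minimum positive co-degree *)

Section Codegree.
Variables (V : finType) (H : threegraph V).
Implicit Types p e : {set V}.

Lemma card_edge e : e \in edges H -> #|e| = 3.
Proof. by move=> eH; have /'forall_implyP/(_ e eH)/eqP := edges_card H. Qed.

(** An edge containing [p] is [w |: p] for exactly one vertex [w], which lies outside [p] because
    edges have three elements. *)
Lemma codegreeE p : #|p| = 2 ->
  codegree H p = #|[set w | w |: p \in edges H]%SET|.
Proof.
move=> p2; rewrite /codegree.
have notin w : w |: p \in edges H -> w \notin p.
  by move=> /card_edge; rewrite cardsU1 p2; case: (w \in p).
rewrite -(@card_in_imset _ _ (fun w => w |: p)); last first.
  move=> w w'; rewrite !inE => /notin wp /notin w'p /setP/(_ w).
  by rewrite !inE eqxx (negPf wp) !orbF => /esym/eqP.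
apply: eq_card => e; apply/idP/imsetP => [|[w]]; rewrite !inE; last first.
  by move=> wH ->; rewrite wH subsetUr.
case/andP=> eH pe.
have /eqP/cards1P[w ew] : #|e :\: p| = 1.
  by rewrite cardsDS // (card_edge eH) p2.
have eE : e = w |: p by rewrite -ew setUC -[LHS](setID e p) (setIidPr pe).
by exists w; rewrite ?inE -?eE.
Qed.

Lemma min_pos_codegree_le p :
  covered_pair H p -> min_pos_codegree H <= codegree H p.
Proof.
move=> Hp; rewrite /min_pos_codegree; case: ifP => // _.
by apply/bigmax_leqP => k /forallP/(_ p)/implyP/(_ Hp).
Qed.

Lemma exists_covered_pair e : e \in edges H -> exists p, covered_pair H p.
Proof.
move=> eH; have [x xe] : exists x, x \in e.
  by apply/card_gt0P; rewrite (card_edge eH).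
exists (e :\ x); apply/andP; split.
  by have := cardsD1 x e; rewrite xe (card_edge eH) add1n => -[<-].
by apply/existsP; exists e; rewrite eH subsetDl.
Qed.

Lemma le_min_pos_codegree k : edges H != set0 ->
  (forall p, covered_pair H p -> k <= codegree H p) -> k <= min_pos_codegree H.
Proof.
move=> H0 kH; rewrite /min_pos_codegree (negPf H0).
have [e eH] := set0Pn _ H0; have [p pH] := exists_covered_pair eH.
have kE : k < #|edges H|.+1.
  rewrite ltnS (leq_trans (kH _ pH))// /codegree subset_leq_card//.
  by apply/subsetP => e'; rewrite inE => /andP[].
apply: (bigmax_sup (Ordinal kE)) => //.
by apply/forallP => q; apply/implyP/kH.
Qed.

Lemma min_pos_codegree_le_card : min_pos_codegree H <= #|V|.
Proof.
have [H0|/set0Pn[e /exists_covered_pair[p pH]]] := eqVneq (edges H) set0.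
  by rewrite /min_pos_codegree H0 eqxx.
apply: leq_trans (min_pos_codegree_le pH) _.
by rewrite codegreeE ?max_card//; case/andP: pH => /eqP.
Qed.

End Codegree.

(** * Blow-ups along a map [phi] *)

Section Blowup.
Variables (V W : finType) (phi : V -> W) (H : threegraph W).

(** Edges of [H] have three elements, so an edge of the blow-up meets three different fibres of
    [phi], once each. *)
Definition blowup_edges := [set e : {set V} | #|e| == 3 & phi @: e \in edges H]%SET.

Fact blowup_edges_card : [forall e in blowup_edges, #|e| == 3].
Proof. by apply/'forall_implyP => e; rewrite inE => /andP[]. Qed.

Definition blowup : threegraph V := ThreeGraph blowup_edges_card.

Lemma blowup_inj e : e \in edges blowup -> {in e &, injective phi}.
Proof.
rewrite inE => /andP[/eqP e3 /card_edge pe3].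
by apply/imset_injP; rewrite e3 pe3.
Qed.

Lemma covered_pair_blowup (p : {set V}) :
  covered_pair blowup p -> covered_pair H (phi @: p).
Proof.
case/andP=> p2 /existsP[e /andP[eB pe]].
apply/andP; split; last first.
  apply/existsP; exists (phi @: e); rewrite imsetS// andbT.
  by move: eB; rewrite inE => /andP[].
rewrite card_in_imset// => x y /(subsetP pe) xe /(subsetP pe) ye.
exact: (blowup_inj eB).
Qed.

(** The vertices completing [p] to an edge form the preimage of those completing [phi @: p], a
    disjoint union of fibres of size at least [t]. *)
Lemma codegree_blowup t (p : {set V}) :
    (forall w, t <= #|phi @^-1: [set w]|) -> covered_pair blowup p ->
  t * codegree H (phi @: p) <= codegree blowup p.
Proof.
move=> fib pB; have /andP[/eqP php2 _] := covered_pair_blowup pB.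
have /andP[/eqP p2 _] := pB.
rewrite !codegreeE//; set A := [set w | _].
have -> : [set v | v |: p \in edges blowup] = phi @^-1: A.
  apply/setP => v; rewrite !inE imsetU1; case: (boolP (_ \in edges H)) => [vH|].
    rewrite andbT cardsU1 p2; case: (boolP (v \in p)) => // vp.
    have := card_edge vH.
    by rewrite cardsU1 php2 (imset_f _ vp).
  by rewrite andbF.
rewrite -[#|phi @^-1: A|]sum1_card (partition_big phi (mem A)) => [|v]; last by rewrite inE.
rewrite mulnC -sum_nat_const; apply: leq_sum => w wA.
rewrite sum1_card; apply: leq_trans (fib w) (subset_leq_card _).
by apply/subsetP => v; rewrite !inE => /eqP vw; rewrite unfold_in inE vw -/(_ \in A) wA eqxx.
Qed.

Lemma min_pos_codegree_blowup t : (forall w, t <= #|phi @^-1: [set w]|) ->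
  t * min_pos_codegree H <= min_pos_codegree blowup.
Proof.
move=> fib; case: t fib => [//|t] fib.
have [H0|H0] := eqVneq (edges H) set0.
  by rewrite /min_pos_codegree H0 eqxx muln0.
apply: le_min_pos_codegree => [|p pB]; last first.
  apply: leq_trans (codegree_blowup fib pB).
  by rewrite leq_mul2l min_pos_codegree_le ?orbT// covered_pair_blowup.
have [e eH] := set0Pn _ H0.
(* All fibres are non-empty here, so a section of [phi] carries an edge of [H] to one of the
   blow-up. *)
have sect w : {v | phi v == w}.
  apply: sigW; have /card_gt0P[v] := leq_trans (ltn0Sn t) (fib w).
  by rewrite !inE; exists v.
pose s w := sval (sect w); have sK : cancel s phi by move=> w; exact/eqP/(svalP (sect w)).
apply/set0Pn; exists (s @: e); rewrite inE -imset_comp.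
rewrite (eq_imset (g := id)) ?imset_id// eH andbT.
by rewrite card_imset ?(card_edge eH)//; apply: can_inj sK.
Qed.

Definition covers_pairs (U : finType) (F : threegraph U) :=
  forall x y : U, x != y -> exists2 e, e \in edges F & (x \in e) && (y \in e).

(** Two vertices of a copy of [F] share an edge, on which [phi] is injective; hence [phi] is
    injective on the whole copy and maps it to a copy in [H]. *)
Lemma hfree_blowup (U : finType) (F : threegraph U) :
  covers_pairs F -> hfree F H -> hfree F blowup.
Proof.
move=> Fcov; apply: contra => /existsP[f /andP[/injectiveP f_inj fF]].
have {}fF e : e \in edges F -> f @: e \in edges blowup.
  by move: e; apply/'forall_implyP.
apply/existsP; exists [ffun x => phi (f x)]; apply/andP; split.
  apply/injectiveP => x y; rewrite !ffunE; apply: contra_eq => xy.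
  have [e /fF eB /andP[xe ye]] := Fcov x y xy.
  by apply: contra_neq xy => /(blowup_inj eB)/f_inj->//; apply: imset_f.
apply/'forall_implyP => e /fF; rewrite inE -imset_comp => /andP[_].
suff -> : [ffun x => phi (f x)] @: e = (phi \o f) @: e by [].
by apply: eq_imset => x; rewrite ffunE.
Qed.

End Blowup.

(** * Bounds on [coex] by balanced blow-ups *)

Lemma leq_card_fiber_mod m n (w : 'I_m.+1) :
  n %/ m.+1 <= #|(fun v : 'I_n => inord (v %% m.+1)) @^-1: [set w]|.
Proof.
pose s (i : 'I_(n %/ m.+1)) : nat := i * m.+1 + w.
have sn i : s i < n.
  rewrite /s (@leq_trans (i.+1 * m.+1))//; first by rewrite mulSn addnC ltn_add2r.
  by rewrite (leq_trans _ (leq_divM n m.+1))// leq_mul2r ltn_ord.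
rewrite -[leqLHS]card_ord -(@card_imset _ _ (fun i => Ordinal (sn i))).
  apply/subset_leq_card/subsetP => _ /imsetP[i _ ->].
  by rewrite !inE /= /s modnMDl modn_small// inord_val.
move=> i j /(congr1 val)/= /eqP.
by rewrite /s eqn_add2r eqn_pmul2r// => /eqP/val_inj.
Qed.

Lemma coex_ge (U : finType) (F : threegraph U) n (H : threegraph 'I_n) :
  hfree F H -> min_pos_codegree H <= coex n F.
Proof. by move=> HF; apply: leq_bigmax_cond. Qed.

Lemma coex_le (U : finType) (F : threegraph U) n : coex n F <= n.
Proof.
apply/bigmax_leqP => H _.
by apply: leq_trans (min_pos_codegree_le_card H) _; rewrite card_ord.
Qed.

(** Residues modulo [m] split the [n] vertices into classes of size at least [n %/ m], along which
    every [F]-free 3-graph on [m] vertices is blown up. *)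
Lemma coex_blowup (U : finType) (F : threegraph U) m n :
  covers_pairs F -> 0 < m -> (n %/ m) * coex m F <= coex n F.
Proof.
move=> Fcov; case: m => // m _.
rewrite /coex (big_morph (muln _) (maxnMr _) (muln0 _)).
apply/bigmax_leqP => H HF.
apply: leq_trans (min_pos_codegree_blowup H (@leq_card_fiber_mod m n)) _.
exact/coex_ge/hfree_blowup.
Qed.

(** [J4] is the cone with apex [ord0], labelled 1, over the complete graph on the other four
    vertices. *)
Lemma J4_edge (x y : 'I_5) : uniq [:: ord0; x; y] -> [set ord0; x; y]%SET \in edges J4.
Proof.
(* The edges of [J4] are listed with increasing labels, so the ordered case matches one
   literally. *)
wlog xy : x y / x <= y => [hw|].
  case: (leqP x y) => [|/ltnW] xy; first exact: hw.
  rewrite setUAC => u; apply: hw => //.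
  by rewrite -(perm_uniq (_ : perm_eq [:: ord0; x; y] _))// perm_cons (perm_catC [:: x]).
move=> u; have -> : [set ord0; x; y] = triple 1 x.+1 y.+1.
  by apply/setP => v; rewrite !inE !eqSS orbA.
move: x y xy u.
by do 2![case=> [[|[|[|[|[|//]]]]] ?]] => //= _; rewrite ?inE ?eqxx ?orbT.
Qed.

Lemma J4_covers_pairs : covers_pairs J4.
Proof.
have cov0 (x : 'I_5) : x != ord0 -> exists2 e, e \in edges J4 & (ord0 \in e) && (x \in e).
  move=> x0; have [y /andP[y0 yx]] : exists y : 'I_5, (y != ord0) && (y != x).
    have [->|x1] := eqVneq x (inord 1).
      by exists (inord 2); rewrite -!val_eqE /= !inordK.
    by exists (inord 1); rewrite (eq_sym _ x) x1 -val_eqE /= inordK.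
  exists [set ord0; y; x]; last by rewrite !inE !eqxx !orbT.
  by apply: J4_edge; rewrite /= !inE negb_or !(eq_sym ord0) y0 yx x0.
move=> x y; have [->|x0] := eqVneq x ord0; first by rewrite eq_sym => /cov0.
have [->|y0] := eqVneq y ord0.
  by move=> /cov0[e eJ]; exists e => //; rewrite andbC.
move=> xy; exists [set ord0; x; y]; last by rewrite !inE !eqxx !orbT.
by apply: J4_edge; rewrite /= !inE negb_or !(eq_sym ord0) x0 y0 xy.
Qed.

(** * The complement of the Fano plane *)

(* {0, 1, 3} is a perfect difference set modulo 7: its translates are the
    lines of the Fano plane. *)
Definition on_line (a i : nat) := (i + a) %% 7 \in [:: 0; 1; 3].

(** Lists of natural numbers let the finite checks below be decided by computation. *)
Definition collinear (s : seq nat) := has (fun a => all (on_line a) s) (iota 0 7).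

Definition coFano_edges : {set {set 'I_7}} :=
  [set e : {set 'I_7} | #|e| == 3 & ~~ collinear [seq val i | i in e]]%SET.

Fact coFano_edges_card : [forall e in coFano_edges, #|e| == 3].
Proof. by apply/'forall_implyP => e; rewrite inE => /andP[]. Qed.

Definition coFano : threegraph 'I_7 := ThreeGraph coFano_edges_card.

Lemma coFano_edgeE (x y z : 'I_7) : ([set x; y; z]%SET \in edges coFano) =
  uniq [:: val x; val y; val z] && ~~ collinear [:: val x; val y; val z].
Proof.
have -> : [set x; y; z] = [set:: [:: x; y; z]] by apply/setP=> v; rewrite !inE orbA.
rewrite inE cardsE -[uniq _]/(uniq (map val [:: x; y; z])); congr (_ && ~~ _).
  by rewrite (map_inj_uniq val_inj); exact/eqP/card_uniqP.
apply: eq_has => a; rewrite -[RHS]/(all _ (map val [:: x; y; z])) !all_map.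
by apply: eq_all_r => v; rewrite mem_enum inE.
Qed.

Lemma forall_iota (n : nat) (P : pred nat) : all P (iota 0 n) -> forall i : 'I_n, P i.
Proof. by move=> /allP PP i; apply: PP; rewrite mem_iota /=. Qed.

(** The line through two points contains a single further point; each of the other four points
    completes the pair to an edge. *)
Lemma coFano_min_pos_codegree : 4 <= min_pos_codegree coFano.
Proof.
apply: le_min_pos_codegree => [|p /andP[p2 _]].
  apply/set0Pn; exists [set inord 0; inord 1; inord 2].
  by rewrite coFano_edgeE /= !inordK.
rewrite codegreeE; last exact/eqP.
case/cards2P: p2 => x [y [xy ->]].
have -> : [set w | w |: [set x; y] \in edges coFano] =
   [set w : 'I_7 | uniq [:: val w; val x; val y] && ~~ collinear [:: val w; val x; val y]].
  by apply/setP => w; rewrite inE setUA coFano_edgeE [RHS]inE.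
rewrite cardsE cardE size_filter.
rewrite -(count_map val (fun w => uniq [:: w; val x; val y] && ~~ collinear [:: w; val x; val y])).
rewrite -enumT val_enum_ord; apply/implyP: xy; rewrite -val_eqE.
pose deg i j := count (fun w => uniq [:: w; i; j] && ~~ collinear [:: w; i; j]) (iota 0 7).
have deg_ge4 : all (fun i => all (fun j => (i != j) ==> (4 <= deg i j)) (iota 0 7)) (iota 0 7).
  by vm_compute.
exact: (forall_iota (forall_iota deg_ge4 x) y).
Qed.

(** The three lines through a point pair up the other six points, so among any four of these some
    two are collinear with it. All choices are checked by computation. *)
Lemma coFano_free : hfree J4 coFano.
Proof.
apply/negP => /existsP[f /andP[/injectiveP f_inj /'forall_implyP fJ]].
have ncol x y : uniq [:: ord0; x; y] -> collinear [:: val (f ord0); val (f x); val (f y)] = false.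
  by move=> /J4_edge/fJ; rewrite !imsetU !imset_set1 coFano_edgeE => /andP[_ /negPf].
pose K4_hit (v a b c d : nat) := uniq [:: v; a; b; c; d] ==>
  [|| collinear [:: v; a; b], collinear [:: v; a; c], collinear [:: v; a; d],
      collinear [:: v; b; c], collinear [:: v; b; d] | collinear [:: v; c; d]].
pose all7 P := all P (iota 0 7).
have link_K4_free : all7 (fun v => all7 (fun a => all7 (fun b =>
    all7 (fun c => all7 (K4_hit v a b c))))).
  by vm_compute.
pose o i : 'I_5 := inord i.
have := forall_iota (forall_iota (forall_iota (forall_iota (forall_iota
  link_K4_free (f ord0)) (f (o 1))) (f (o 2))) (f (o 3))) (f (o 4)).
(* The embedding excludes all six collinearities, leaving only the claim that the five images are
   not distinct. *)
rewrite /K4_hit !ncol; try by rewrite /= !inE -!val_eqE /= !inordK.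
apply/negP; rewrite implybF negbK.
rewrite -[uniq _]/(uniq (map (val \o f) [:: ord0; o 1; o 2; o 3; o 4])).
rewrite map_inj_uniq; last exact: inj_comp val_inj f_inj.
by rewrite /= !inE -!val_eqE /= !inordK.
Qed.

Lemma coex7_J4 : 4 <= coex 7 J4.
Proof. exact: leq_trans coFano_min_pos_codegree (coex_ge coFano_free). Qed.

End ThreeGraphs.

(** * Convergence of the ratios to their supremum *)

Local Open Scope classical_set_scope.

(** As in Fekete's lemma, the limit is the supremum: if the ratio at [m] is close to it, the ratio
    at a large [n] is smaller than that by at most [m / n]. *)
Lemma cvg_ratio_ubound (R : realType) (a : nat -> nat) :
    (forall n, a n <= n)%N ->
    (forall m n, (0 < m)%N -> (n %/ m * a m <= a n)%N) ->
  exists2 l : R, (fun n => (a n)%:R / n%:R)%R @ \oo --> l &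
    forall n, ((a n)%:R / n%:R <= l)%R.
Proof.
move=> a_le a_mul; pose u n : R := ((a n)%:R / n%:R)%R; set s := sup (range u).
have u_ubound : has_ubound (range u).
  exists 1%R => _ [n _ <-]; rewrite /u; case: n => [|n].
    by rewrite invr0 mulr0 ler01.
  by rewrite ler_pdivrMr ?ltr0Sn// mul1r ler_nat.
have u_le n : (u n <= s)%R by apply: ub_le_sup => //; exists n.
have hs : has_sup (range u) by split=> //; exists (u 0%N), 0%N.
exists s => //; apply/cvgrPdist_le => /= e e0; rewrite -/u.
have [m m_gt0 um] : exists2 m, (0 < m)%N & (s - e / 2 < u m)%R.
  have [_ [[|m] _ <-] um] := sup_adherent (divr_gt0 e0 (ltr0Sn R 1)) hs.
    (* Division by zero makes [u 0] zero, so [u 1] is no smaller and replaces it. *)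
    exists 1%N => //; apply: lt_le_trans um _.
    by rewrite /u invr0 mulr0 divr1.
  by exists m.+1.
near=> n.
have n_gt0 : (0 < n)%N by near: n; exact: nbhs_infty_gt.
have mn : (m%:R / n%:R <= e / 2 :> R)%R.
  rewrite ler_pdivrMr ?ltr0n// mulrC -ler_pdivrMr ?divr_gt0//.
  by near: n; exact: nbhs_infty_ger.
(* In [n = n %/ m * m + n %% m], the first term is controlled by [a_mul], the remainder by
   [a m <= m] and [n %% m < m]. *)
have umn : (u m <= u n + m%:R / n%:R)%R.
  rewrite /u -mulrDl ler_pdivrMr ?ltr0n// mulrAC ler_pdivlMr ?ltr0n//.
  rewrite -natrD -!natrM ler_nat [in leqLHS](divn_eq n m) mulnDr mulnDl.
  apply: leq_add; first by rewrite mulnA leq_mul2r mulnC a_mul// orbT.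
  by rewrite mulnC leq_mul ?a_le// ltnW// ltn_pmod.
have {mn}umn := lt_le_trans um (le_trans umn (lerD (lexx _) mn)).
by rewrite -/(u n) ger0_norm ?subr_ge0//; lra.
Unshelve. all: by end_near. Qed.

Theorem mainTheorem10 (R : realType) :
  (forall n : nat, (0 < n)%N -> (4 * (n %/ 7) <= coex n J4)%N) /\
  ((4%:R / 7%:R : R) <= gamma_plus R J4)%R.
Proof.
split=> [n _|].
  apply: leq_trans (coex_blowup n J4_covers_pairs (isT : 0 < 7)%N).
  by rewrite mulnC leq_mul2l coex7_J4 orbT.
have a_mul m n : (0 < m)%N -> (n %/ m * coex m J4 <= coex n J4)%N.
  exact: coex_blowup J4_covers_pairs.
have a_le n : (coex n J4 <= n)%N by exact: coex_le.
have [l a_l le_l] := cvg_ratio_ubound R a_le a_mul.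
(* The limit dominates every ratio, in particular the one at 7. *)
rewrite /gamma_plus (cvg_lim _ a_l)//; apply: le_trans (le_l 7%N).
by rewrite ler_pM2r ?invr_gt0 ?ltr0n// ler_nat coex7_J4.
Qed.
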